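(* For each prime power $q$ with $q\equiv 2\pmod 3$, $M(q,q-3)\ge (q+1)q(q-1)$.
   Context: $M(m,d)$ denotes the maximum size of a set of permutations of an $m$-element set in which every two distinct permutations have Hamming distance at least $d$, where the Hamming distance of two permutations is the number of points at which they differ.
   Formalization: The case q = 2 is excluded by assuming q > 3: there the distance q − 3 is negative and the bound fails, since there are only 2 permutations of 2 points while (q+1)q(q−1) = 6. *)

(* Defs.v *)
From mathcomp Require Import all_boot all_fingroup.

Set Implicit Arguments.
Unset Strict Implicit.
Unset Printing Implicit Defensive.

Definition prime_power (q : nat) : Prop :=
  exists p k : nat, [/\ prime p, 0 < k & q = p ^ k].

Definition hamming (T : finType) (s t : {perm T}) : nat :=
  #|[set x | s x != t x]|.

Definition permutation_array (T : finType) (d : nat) (A : {set {perm T}}) : bool :=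
  [forall s in A, forall t in A, (s != t) ==> (d <= hamming s t)].

(* The empty set is always a permutation array, so the maximum ranges over a
   nonempty family.  The m-element set is {0, ..., m-1}. *)
Definition M (m d : nat) : nat :=
  \max_(A : {set 'S_m} | permutation_array d A) #|A|.

(* Main.v *)
Require Import Defs.
From mathcomp Require Import all_boot all_fingroup.
From mathcomp Require Import all_solvable all_algebra finfield.
From mathcomp Require Import ring.

Set Implicit Arguments.
Unset Strict Implicit.
Unset Printing Implicit Defensive.

(* Contract the action of PGL(2, q) on the projective line to F_q: a
    permutation [s] that moves infinity is changed at the preimage of infinity,
    where it takes the value [s] has at infinity.  With [0^-1 = 0], the result is
    [x |-> b + a / (x - t)].  Two distinct such maps, or affine maps, agree where
    a nonzero quadratic vanishes or at a pole.  This leaves at most three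
    agreements, except perhaps for two maps with distinct poles.  If these agree
    at both poles, then any other agreement yields a root of [z^2 + z + 1], that
    is, a primitive cube root of unity, as the characteristic is not 3; there is
    none when q = 2 mod 3. *)

Lemma hamming_agree (T : finType) (s t : {perm T}) :
  hamming s t = #|T| - #|[set x | s x == t x]|.
Proof.
rewrite /hamming cardsCs; congr (_ - #|pred_of_set _|).
by apply/setP=> x; rewrite !inE negbK.
Qed.

Section Transport.

Variable T : finType.

(** Conjugation by the enumeration of [T]: the array is built on the field, while [M] is defined
    over ordinals. *)
Definition rank_perm_fun (s : {perm T}) (i : 'I_#|T|) : 'I_#|T| :=
  enum_rank (s (enum_val i)).

Lemma rank_perm_fun_inj s : injective (rank_perm_fun s).
Proof. by move=> i j /enum_rank_inj/perm_inj/enum_val_inj. Qed.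

Definition rank_perm s : 'S_#|T| := perm (@rank_perm_fun_inj s).

Lemma rank_perm_inj : injective rank_perm.
Proof.
move=> s t /permP st; apply/permP=> x.
by have := st (enum_rank x); rewrite !permE /rank_perm_fun enum_rankK => /enum_rank_inj.
Qed.

Lemma hamming_rank_perm s t : hamming (rank_perm s) (rank_perm t) = hamming s t.
Proof.
rewrite /hamming -[RHS](card_imset _ (@enum_rank_inj T)).
congr #|pred_of_set _|; apply/setP=> i; rewrite -[i]enum_valK mem_imset; last exact: enum_rank_inj.
by rewrite !inE !permE /rank_perm_fun enum_rankK (inj_eq enum_rank_inj).
Qed.

Lemma card_le_M d (A : {set {perm T}}) :
  permutation_array d A -> #|A| <= M #|T| d.
Proof.
move=> dA; rewrite -(card_imset _ rank_perm_inj) /M.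
apply: (leq_bigmax_cond (F := fun B : {set 'S_#|T|} => #|B|)).
apply/forall_inP=> _ /imsetP[s sA ->]; apply/forall_inP=> _ /imsetP[t tA ->].
rewrite (inj_eq rank_perm_inj) hamming_rank_perm.
by move/forall_inP: dA => /(_ s sA)/forall_inP/(_ t tA).
Qed.

End Transport.

Import GRing.Theory.
Local Open Scope ring_scope.

(** The case [a = 0] is allowed so that linear equations are covered too. *)
Lemma card_quadratic_roots (F : finFieldType) (a b c : F) :
  [|| a != 0, b != 0 | c != 0] ->
  (#|[set x | (a * x ^+ 2 + b * x + c == 0)%R]| <= 2)%N.
Proof.
move=> abc; pose p := Poly [:: c; b; a].
have p0 : p != 0.
  apply: contraL abc => /eqP p0; rewrite !negb_or !negbK.
  have E i : p`_i = 0 by rewrite p0 coef0.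
  move: (E 0%N) (E 1%N) (E 2%N); rewrite !coef_Poly /= => -> -> ->.
  by rewrite eqxx.
rewrite cardE -ltnS; apply: leq_trans (size_Poly [:: c; b; a]).
apply: max_poly_roots p0 _ (enum_uniq _).
apply/allP=> x; rewrite mem_enum inE => /eqP e; apply/rootP.
by rewrite horner_Poly /= -[RHS]e; ring.
Qed.

Section Contraction.

Variable F : finFieldType.

(* The first component is the pole; [None] stands for infinity. *)
Definition contracted (v : option F * F * F) (x : F) : F :=
  let: (o, b, a) := v in if o is Some t then b + a / (x - t) else a * x + b.

Definition agreement v w := [set x | contracted v x == contracted w x].

Lemma contracted_inj v : v.2 != 0 -> injective (contracted v).
Proof.
case: v => [[[t|] b] a] /= a0 x y.
  by move/addrI/(mulfI a0)/invr_inj/addIr.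
by move/addIr/(mulfI a0).
Qed.

Lemma card_agreement_affine b a b' a' :
  (None, b, a) != (None, b', a') :> option F * F * F ->
  (#|agreement (None, b, a) (None, b', a')| <= 2)%N.
Proof.
move=> ne; pose R := [set x | 0 * x ^+ 2 + (a - a') * x + (b - b') == 0].
have sub : agreement (None, b, a) (None, b', a') \subset R.
  apply/subsetP=> x; rewrite !inE /= -subr_eq0 => /eqP e.
  by apply/eqP; rewrite -[RHS]e; ring.
apply: leq_trans (subset_leq_card sub) _; apply: card_quadratic_roots.
rewrite eqxx /= !subr_eq0 -negb_and; apply: contra ne.
by case/andP=> /eqP-> /eqP->.
Qed.

(** Multiplying by [x - t] gives a quadratic with leading coefficient [a]; the pole, where the
    quotient is 0 by convention, is counted apart. *)
Lemma card_agreement_affine_pole (b a t b' a' : F) : a != 0 ->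
  (#|agreement (None, b, a) (Some t, b', a')| <= 3)%N.
Proof.
move=> a0; pose R := [set x | a * x ^+ 2 + (b - b' - a * t) * x
                              + ((b' - b) * t - a') == 0].
have sub : agreement (None, b, a) (Some t, b', a') \subset t |: R.
  apply/subsetP=> x; rewrite !inE /= -[x == t]subr_eq0.
  case: (eqVneq (x - t) 0) => //= xt /eqP e; apply/eqP.
  have -> : a' = a' / (x - t) * (x - t) by rewrite divfK.
  have -> : a' / (x - t) = a * x + b - b' by rewrite e; ring.
  by ring.
apply: leq_trans (subset_leq_card sub) _; rewrite cardsU1.
apply: (@leq_add _ _ 1 2); first exact: leq_b1.
by apply: card_quadratic_roots; rewrite a0.
Qed.

Lemma card_agreement_same_pole t b a b' a' :
  (Some t, b, a) != (Some t, b', a') ->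
  (#|agreement (Some t, b, a) (Some t, b', a')| <= 3)%N.
Proof.
move=> ne.
pose R := [set x | 0 * x ^+ 2 + (b - b') * x + ((b' - b) * t + (a - a')) == 0].
have sub : agreement (Some t, b, a) (Some t, b', a') \subset t |: R.
  apply/subsetP=> x; rewrite !inE /= -[x == t]subr_eq0.
  case: (eqVneq (x - t) 0) => //= xt /eqP e; apply/eqP.
  have {e} : (b + a / (x - t)) * (x - t) = (b' + a' / (x - t)) * (x - t) by rewrite e.
  rewrite !mulrDl !divfK // => /eqP; rewrite -subr_eq0 => /eqP e.
  by rewrite -[RHS]e; ring.
apply: leq_trans (subset_leq_card sub) _; rewrite cardsU1.
apply: (@leq_add _ _ 1 2); first exact: leq_b1.
apply: card_quadratic_roots; rewrite eqxx /= subr_eq0.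
apply: contraR ne; rewrite negb_or !negbK => /andP[/eqP->].
by rewrite subrr mul0r add0r subr_eq0 => /eqP->.
Qed.

Hypothesis qmod : #|F| = 2 %[mod 3].

Lemma card_natr_finField : #|F|%:R = 0 :> F.
Proof.
(* Lagrange in the additive group of [F], whose powers are multiples. *)
have := expg_cardG (in_setT (1 : F)).
by rewrite FinRing.zmodXgE cardsT.
Qed.

(** A root has [z ^+ 3 = 1], so [z ^+ #|F| = z] becomes [z ^+ 2 = z]. Hence [z = 1] and 3 = 0 in
    [F]; but then [#|F|%:R = 0] says 2 = 0. *)
Lemma no_primitive_cube_root (z : F) : z ^+ 2 + z + 1 != 0.
Proof.
apply/eqP=> z0.
have q3 : #|F| = ((#|F| %/ 3) * 3 + 2)%N by rewrite {1}(divn_eq #|F| 3) qmod.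
have z3 : z ^+ 3 = 1.
  apply/eqP; rewrite -subr_eq0; apply/eqP.
  by transitivity ((z - 1) * (z ^+ 2 + z + 1)); [ring | rewrite z0 mulr0].
have zz : z ^+ 2 = z.
  by rewrite -[RHS]expf_card q3 exprD mulnC exprM z3 expr1n mul1r.
have z_neq0 : z != 0.
  by apply: contra_eq_neq z0 => ->; rewrite expr0n /= !add0r oner_neq0.
have z1 : z = 1 by apply: (mulfI z_neq0); rewrite mulr1 -expr2.
have c3 : 3%:R = 0 :> F by rewrite -z0 z1; ring.
have := card_natr_finField; rewrite q3 natrD natrM c3 mulr0 add0r => c2.
have /eqP : 1 = 0 :> F by rewrite -(subrr (0 : F)) -{1}c3 -c2; ring.
by rewrite oner_eq0.
Qed.

Lemma card_agreement_distinct_poles (t b a t' b' a' : F) : t != t' -> a != 0 ->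
  (#|agreement (Some t, b, a) (Some t', b', a')| <= 3)%N.
Proof.
move=> tt' a0; set E := agreement _ _.
pose R := [set x | (b - b') * x ^+ 2 + (a - a' - (b - b') * (t + t')) * x
                   + ((b - b') * t * t' - a * t' + a' * t) == 0].
have s0 : t - t' != 0 by rewrite subr_eq0.
have ER x : x \in E -> x != t -> x != t' ->
    (b - b') * ((x - t) * (x - t')) + a * (x - t') - a' * (x - t) = 0.
  rewrite inE /= -[x == t]subr_eq0 -[x == t']subr_eq0 => /eqP e xt xt'.
  transitivity ((b + a / (x - t) - (b' + a' / (x - t'))) * ((x - t) * (x - t'))).
    by field; rewrite xt xt'.
  by rewrite e subrr mul0r.
have cR : (#|R| <= 2)%N.
  apply: card_quadratic_roots.
  (* This is the value of the quadratic at [t], so its coefficients cannot all vanish. *)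
  have : a * (t - t') != 0 by rewrite mulf_neq0.
  apply: contraR; rewrite !negb_or !negbK => /and3P[/eqP e2 /eqP e1 /eqP e0].
  apply/eqP; transitivity ((b - b') * t ^+ 2 + (a - a' - (b - b') * (t + t')) * t
                   + ((b - b') * t * t' - a * t' + a' * t)); first by ring.
  by rewrite e0 e1 e2 !mul0r !addr0.
have sub : E \subset t |: (t' |: R).
  apply/subsetP=> x xE; rewrite !inE.
  case: (eqVneq x t) => //= xt; case: (eqVneq x t') => //= xt'.
  by apply/eqP; rewrite -[RHS](ER x xE xt xt'); ring.
have one_pole u : E \subset u |: R -> (#|E| <= 3)%N.
  move/subset_leq_card/leq_trans; apply; rewrite cardsU1.
  by apply: (@leq_add _ _ 1 2); first exact: leq_b1.
(* If the maps disagree at a pole, only the other pole adds to the two roots. *)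
case: (boolP (t \in E)) => [tE|tNE]; last first.
  apply: (one_pole t'); apply/subsetP=> x xE; move/subsetP: sub => /(_ x xE).
  by rewrite in_setU1; case: eqVneq xE => // ->; rewrite (negPf tNE).
case: (boolP (t' \in E)) => [t'E|t'NE]; last first.
  apply: (one_pole t); apply/subsetP=> x xE; move/subsetP: sub => /(_ x xE).
  rewrite !in_setU1.
  by case: (eqVneq x t') xE => // ->; rewrite (negPf t'NE).
have sub2 : E \subset [set t; t'].
  apply/subsetP=> x xE; rewrite !inE; apply: contraT; rewrite negb_or => /andP[xt xt'].
  have := ER x xE xt xt'.
  move: tE; rewrite inE /= subrr invr0 mulr0 addr0 => /eqP bE.
  move: t'E; rewrite inE /= subrr invr0 mulr0 addr0 => /eqP b'E.
  (* Agreement at both poles forces [a] and [a'] to have this common value. *)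
  have a'E : a' = (b - b') * (t - t') by rewrite bE; field.
  have aE : a = (b - b') * (t - t').
    by rewrite -b'E; field; rewrite -opprB oppr_eq0.
  have w0 : b - b' != 0 by apply: contraNneq a0 => w0; rewrite aE w0 mul0r.
  (* With this [z], the equation [e] reads [(b - b') * (t - t') ^+ 2 * (z ^+ 2 + z + 1) = 0]. *)
  move=> e; have := no_primitive_cube_root (- (x - t') / (t - t')).
  case/negP; apply/eqP; apply: (mulfI w0); apply: (mulfI (expf_neq0 2 s0)).
  rewrite !mulr0 -[RHS]e {1}aE a'E; field; exact: s0.
by apply: leq_trans (subset_leq_card sub2) _; rewrite cards2; case: eqP.
Qed.

Lemma card_agreement v w : v != w -> v.2 != 0 -> w.2 != 0 ->
  (#|agreement v w| <= 3)%N.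
Proof.
case: v w => [[[t|] b] a] [[[t'|] b'] a'] /= ne a0 a'0.
- have [tt'|tt'] := eqVneq t t'; last exact: card_agreement_distinct_poles.
  by move: ne; rewrite -tt'; apply: card_agreement_same_pole.
- suff -> : agreement (Some t, b, a) (None, b', a')
          = agreement (None, b', a') (Some t, b, a).
    exact: card_agreement_affine_pole.
  by apply/setP=> x; rewrite !inE eq_sym.
- exact: card_agreement_affine_pole.
- exact: leq_trans (card_agreement_affine ne) _.
Qed.

(** The default makes this total: for [v.2 = 0] the map is constant, not a permutation. *)
Definition contracted_perm v : {perm F} :=
  odflt 1%g [pick s : {perm F} | [forall x, s x == contracted v x]].

Lemma contracted_permE v x : v.2 != 0 -> contracted_perm v x = contracted v x.
Proof.
move=> v0; rewrite /contracted_perm; case: pickP => [s /forallP/(_ x)/eqP //|].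
move/(_ (perm (contracted_inj v0)))/negP; case.
by apply/forallP=> y; rewrite permE.
Qed.

Definition parameters := setX [set: option F * F] [set~ (0 : F)].

Lemma card_parameters : #|parameters| = ((#|F| + 1) * #|F| * (#|F| - 1))%N.
Proof.
by rewrite cardsX cardsT card_prod card_option cardsC1 addn1 subn1.
Qed.

Lemma hamming_contracted v w : v \in parameters -> w \in parameters -> v != w ->
  (#|F| - 3 <= hamming (contracted_perm v) (contracted_perm w))%N.
Proof.
rewrite !inE /= => v0 w0 vw; rewrite hamming_agree leq_sub2l //.
have -> : [set x | contracted_perm v x == contracted_perm w x] = agreement v w.
  by apply/setP=> x; rewrite !inE !contracted_permE.
exact: card_agreement.
Qed.

Lemma M_contraction : (3 < #|F|)%N ->
  ((#|F| + 1) * #|F| * (#|F| - 1) <= M #|F| (#|F| - 3))%N.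
Proof.
(* Distinct parameters give permutations at distance at least [#|F| - 3], which is positive, so they
   are distinct and none is lost in the count. *)
move=> q3; have inj : {in parameters &, injective contracted_perm}.
  move=> v w vP wP e; apply: contraTeq q3 => /(hamming_contracted vP wP).
  rewrite e /hamming; have -> : [set x | contracted_perm w x != contracted_perm w x] = set0.
    by apply/setP=> x; rewrite !inE eqxx.
  by rewrite cards0 leqn0 subn_eq0 -leqNgt.
rewrite -card_parameters -(card_in_imset inj); apply: card_le_M.
apply/forall_inP=> _ /imsetP[v vP ->]; apply/forall_inP=> _ /imsetP[w wP ->].
apply/implyP=> ne; apply: hamming_contracted => //.
by apply: contraNneq ne => ->.
Qed.

End Contraction.

Local Close Scope ring_scope.

(* The hypothesis 3 < q says that the distance q - 3 is positive; among the
   prime powers congruent to 2 mod 3 it excludes only q = 2, for which q - 3 is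
   negative and the bound fails (there are 2 permutations of 2 points, but
   (q + 1) q (q - 1) = 6). *)
Theorem theorem4 (q : nat) (hq : prime_power q) (hq3 : q = 2 %[mod 3])
    (hd : 3 < q) :
  (q + 1) * q * (q - 1) <= M q (q - 3).
Proof.
have [p [k [p_pr k0 qE]]] := hq.
have [F _ cF] := pPrimePowerField p_pr k0.
by move: hq3 hd; rewrite qE -cF; apply: M_contraction.
Qed.
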